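(* Let $\lambda$ be the uniform distribution on $[0,1]$. There is no regression estimation procedure that is $L_2(\lambda)$-consistent for the family of stable sequences $(\mathbf{x},\mathbf{y})$ with $x_i\in[0,1]$ and $y_i\in\{0,1\}$ for all $i$, having limiting distribution $\lambda$ and limiting regression $m$ with $V(m:0,1)<\infty$. That is, for every regression estimation procedure $\Phi=\{\phi_1,\phi_2,\ldots\}$ there exist a measurable $m:\mathbb{R}\to\mathbb{R}$ with $\int|m|\,d\lambda<\infty$ and $V(m:0,1)<\infty$ and a pair $(\mathbf{x},\mathbf{y})\in\Omega(\lambda,m)$ with $x_i\in[0,1]$, $y_i\in\{0,1\}$ for all $i$, such that $\int\big(\phi_n(x;(x_1,y_1),\ldots,(x_n,y_n))-m(x)\big)^2\lambda(dx)$ does not converge to $0$ as $n\to\infty$.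
   Context: For a probability distribution $\mu$ on $\mathbb{R}$ and a measurable $m:\mathbb{R}\to\mathbb{R}$ with $\int|m|\,d\mu<\infty$, set $\nu(A)=\int_A m\,d\mu$. For real sequences $\mathbf{x}=(x_1,x_2,\ldots)$, $\mathbf{y}=(y_1,y_2,\ldots)$ let $\hat\mu_n(A)=\frac1n\sum_{i=1}^nI\{x_i\in A\}$ and $\hat\nu_n(A)=\frac1n\sum_{i=1}^ny_iI\{x_i\in A\}$. The pair $(\mathbf{x},\mathbf{y})$ is in $\Omega(\mu,m)$ (stable with limiting distribution $\mu$ and limiting regression $m$) if for every $t\in\mathbb{R}$: $\hat\mu_n(-\infty,t]\to\mu(-\infty,t]$, $\hat\mu_n(\{t\})\to\mu(\{t\})$, $\hat\nu_n(-\infty,t]\to\nu(-\infty,t]$, $\hat\nu_n(\{t\})\to\nu(\{t\})$. The total variation of $h$ on $(a,b]$ is $V(h:a,b)=\sup\sum_{i=1}^n|h(t_i)-h(t_{i-1})|$ over all finite $a<t_0<\cdots<t_n=b$. A regression estimation procedure is a sequence $\Phi=\{\phi_n\}$ where $\phi_n$ assigns to each finite sample $(x_1,y_1),\ldots,(x_n,y_n)$ a measurable function $\phi_n(\cdot;(x_1,y_1),\ldots,(x_n,y_n)):\mathbb{R}\to\mathbb{R}$; it is $L_2(\lambda)$-consistent for a family of pairs if for every pair in the family, with limiting regression $m$, $\int(\phi_n(x;(x_1,y_1),\ldots,(x_n,y_n))-m(x))^2\lambda(dx)\to0$. *)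

(* Defs.v *)
From HB Require Import structures.
From mathcomp Require Import all_boot all_order all_algebra.
From mathcomp Require Import all_classical all_reals all_analysis.
From mathcomp Require Import uniform_distribution.
Set Implicit Arguments. Unset Strict Implicit. Unset Printing Implicit Defensive.
Import Order.TTheory GRing.Theory Num.Theory.
Import numFieldNormedType.Exports.
Local Open Scope classical_set_scope.
Local Open Scope ring_scope.

Section defs.
Variable R : realType.

(* Sequences are indexed from 0: x_1, x_2, ... are x 0, x 1, ... *)

Definition mu_hat (x : nat -> R) (n : nat) (A : set R) : R :=
  n%:R^-1 * \sum_(i < n) (x i \in A)%:R.

Definition nu_hat (x y : nat -> R) (n : nat) (A : set R) : R :=
  n%:R^-1 * \sum_(i < n) (y i * (x i \in A)%:R).

Definition nu_of (mu : {measure set (measurableTypeR R) -> \bar R}) (m : R -> R) (A : set R) : R :=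
  fine (\int[mu]_(z in A) (m z)%:E)%E.

Definition Omega (mu : {measure set (measurableTypeR R) -> \bar R}) (m : R -> R)
    (x y : nat -> R) : Prop :=
  forall t : R,
    [/\ (mu_hat x n `]-oo, t]%classic) @[n --> \oo] --> fine (mu `]-oo, t]%classic),
        (mu_hat x n [set t]) @[n --> \oo] --> fine (mu [set t]),
        (nu_hat x y n `]-oo, t]%classic) @[n --> \oo] --> nu_of mu m `]-oo, t]%classic &
        (nu_hat x y n [set t]) @[n --> \oo] --> nu_of mu m [set t]].

Definition paper_variation (h : R -> R) (a b : R) : \bar R :=
  ereal_sup [set v : \bar R | exists (t0 : R) (s : seq R),
      [/\ a < t0, sorted <%R (t0 :: s), last t0 s = b &
           v = (\sum_(i < size s)
                  `|h (nth 0 s i) - h (nth 0 (t0 :: s) i)|)%:E]].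

Definition sample (x y : nat -> R) (n : nat) : seq (R * R) :=
  [seq (x i, y i) | i <- iota 0 n].

Lemma measurable_01 : measurable (`[0%R, 1%R]%classic : set R).
Proof. exact: measurable_itv. Qed.

Definition lam : {measure set (measurableTypeR R) -> \bar R} :=
  mrestr (@lebesgue_measure R) measurable_01.

End defs.

(* Main.v *)
Require Import Defs.
From HB Require Import structures.
From mathcomp Require Import all_boot all_order all_algebra.
From mathcomp Require Import all_classical all_reals all_analysis.
From mathcomp Require Import measurable_realfun ring lra zify.
Import Order.TTheory GRing.Theory Num.Theory.
Import numFieldNormedType.Exports.
Local Open Scope classical_set_scope.
Local Open Scope ring_scope.

(* The design points run through the regular grids of mesh 1, 1/2, 1/3, ..., and the
   labels are read off a 0/1-valued square wave m_K of frequency K.  If K is eventually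
   constant, the limiting regression is m_K; if K tends slowly to infinity, the
   oscillations average out and the limiting regression is the constant 1/2.  Given
   a consistent procedure, raise K by one each time the estimate has come close to
   m_K.  Along these times the estimate is close to some m_K, hence at L2-distance
   almost 1/2 from the constant 1/2, the limiting regression of the resulting
   sequence: the procedure is not consistent after all. *)

Definition square_wave {R : realType} (K : nat) (x : R) : R :=
  (odd (Num.truncn (K%:R * x)))%:R.

(** For [u >= 0] this is the integral from 0 to [u] of the parity of the integer part: each complete
    pair of unit intervals contributes 1, the last partial interval contributes only if its index is
    odd. *)
Definition square_wave_primitive {R : realType} (u : R) : R :=
  (Num.truncn u)./2%:R + (odd (Num.truncn u))%:R * (u - (Num.truncn u)%:R).

(** * The square wave: primitive, Riemann sums, measurability, variation *)

Section square_wave.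
Context {R : realType}.
Implicit Types (u v t : R) (K N J q : nat).
Local Notation G := (@square_wave_primitive R).

Lemma square_wave01 K t : square_wave K t = 0 \/ square_wave K t = 1.
Proof. by rewrite /square_wave; case: odd; [right|left]. Qed.

Lemma square_wave_ge0 K t : 0 <= square_wave K t.
Proof. exact: ler0n. Qed.

Lemma square_wave_le1 K t : square_wave K t <= 1.
Proof. by rewrite /square_wave lern1 leq_b1. Qed.

(** The primitive is continuous, so the formula of a unit interval extends to its right endpoint. *)
Lemma square_wave_primitiveE q u : q%:R <= u <= q.+1%:R ->
  G u = q./2%:R + (odd q)%:R * (u - q%:R).
Proof.
move=> /andP[qu]; rewrite le_eqVlt => /predU1P[->|uq].
  rewrite /square_wave_primitive natrK subrr mulr0 addr0 /= -natrB// subSnn.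
  by rewrite mulr1 -natrD uphalf_half addnC.
by rewrite /square_wave_primitive (@truncn_def _ u q) ?qu.
Qed.

Lemma square_wave_primitive0 : G 0 = 0.
Proof. by rewrite (@square_wave_primitiveE 0%N) ?lexx ?ler01//= mul0r addr0. Qed.

Lemma square_wave_primitive_incr u v : 0 <= u -> u <= v ->
  0 <= G v - G u <= v - u.
Proof.
move=> u0 uv; have v0 := le_trans u0 uv.
have /andP[qu uq] := truncn_itv u0; have /andP[rv vr] := truncn_itv v0.
have := le_truncn uv; rewrite /square_wave_primitive.
set q := Num.truncn u in qu uq *; set r := Num.truncn v in rv vr *.
rewrite leq_eqVlt => /predU1P[->|qr].
  by case: (odd r) => /=; lra.
have hq : q%:R = (odd q)%:R + 2 * q./2%:R :> R.
  by rewrite -[q in LHS]odd_double_half natrD -mul2n natrM.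
have hr : r%:R = (odd r)%:R + 2 * r./2%:R :> R.
  by rewrite -[r in LHS]odd_double_half natrD -mul2n natrM.
(* [h1] compares [G], and [h2] the complementary primitive [u - G u], at the integers [q + 1] and
   [r]. *)
have h1 : (odd q)%:R + q./2%:R <= r./2%:R :> R by rewrite -natrD ler_nat; lia.
have h2 : 1 + q./2%:R <= (odd r)%:R + r./2%:R :> R.
  by rewrite [1 + _]addrC natr1 -natrD ler_nat; lia.
move: uq vr hq hr h1 h2; rewrite -!natr1; case: (odd q); case: (odd r) => /=; lra.
Qed.

Lemma square_wave_primitive_lipschitz u v : 0 <= u -> 0 <= v ->
  `|G u - G v| <= `|u - v|.
Proof.
wlog uv : u v / v <= u => [H u0 v0|u0 v0].
  have [uv|/ltW uv] := leP v u; first exact: H.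
  by rewrite distrC [`|u - v|]distrC; exact: H.
have /andP[h1 h2] := square_wave_primitive_incr v u v0 uv.
by rewrite !ger0_norm// subr_ge0.
Qed.

(* The left-hand side vanishes when no jump of the wave lies in ]u, v]; otherwise the
   factor counting the jumps is at least 1. *)
Lemma square_wave_step u v : 0 <= u -> u <= v ->
  `|(v - u) * (odd (Num.truncn u))%:R - (G v - G u)| <=
  (v - u) * ((Num.truncn v)%:R - (Num.truncn u)%:R).
Proof.
move=> u0 uv; have v0 := le_trans u0 uv.
have := le_truncn uv; rewrite leq_eqVlt => /predU1P[quv|quv].
  rewrite quv /square_wave_primitive quv subrr mulr0 [X in `|X|](_ : _ = 0) ?normr0//.
  ring.
have /andP[G0 G1] := square_wave_primitive_incr _ _ u0 uv.
have : 1 <= (Num.truncn v)%:R - (Num.truncn u)%:R :> R.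
  by rewrite -natrB ?ler1n ?subn_gt0// ltnW.
set d := (_ - (Num.truncn u)%:R) => d1.
have : v - u <= (v - u) * d by rewrite ler_peMr// subr_ge0.
by rewrite ler_norml; case: odd => /=; lra.
Qed.

(** In the variable [K * x] the mesh is [K / N]. Summing [square_wave_step] telescopes, and the wave
    makes at most [K] jumps, so the error is at most [K * (K / N)]; scaling back divides it by
    [K]. *)
Lemma square_wave_riemann K N J : (0 < K)%N -> (J <= N)%N ->
  `|N%:R^-1 * \sum_(j < J) square_wave K (j%:R / N%:R)
    - G (K%:R * (J%:R / N%:R)) / K%:R| <= K%:R / N%:R :> R.
Proof.
move=> K0 JN.
case: N JN => [|N] JN.
  by rewrite invr0 !mulr0 mul0r square_wave_primitive0 mul0r subr0 normr0.
have KR : 0 < K%:R :> R by rewrite ltr0n.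
have NR : 0 < N.+1%:R :> R by rewrite ltr0n.
pose a j : R := K%:R * (j%:R / N.+1%:R).
have a0 j : 0 <= a j by rewrite /a mulr_ge0 ?divr_ge0.
have aS j : a j.+1 - a j = K%:R / N.+1%:R.
  by rewrite /a -mulrBr -mulrBl -natrB// subSnn mul1r.
have KN0 : 0 < K%:R / N.+1%:R :> R by rewrite divr_gt0.
have H : forall J, `|K%:R / N.+1%:R * \sum_(j < J) square_wave K (j%:R / N.+1%:R)
    - G (a J)| <= K%:R / N.+1%:R * (Num.truncn (a J))%:R.
  elim=> [|j IH].
    by rewrite big_ord0 mulr0 /a mul0r mulr0 square_wave_primitive0 subr0 normr0 truncn0 mulr0.
  rewrite big_ord_recr/=.
  have aj : a j <= a j.+1 by rewrite -subr_ge0 aS ltW.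
  have := square_wave_step _ _ (a0 j) aj; rewrite aS.
  rewrite (_ : (odd _)%:R = square_wave K (j%:R / N.+1%:R) :> R)//.
  move: IH; rewrite !ler_norml !mulrDr !mulrN.
  set c := K%:R / N.+1%:R; move: (G (a j)) (G (a j.+1)) (c * _) (c * _) (c * _) (c * _).
  by move=> *; lra.
have {H} := H J.
have : (Num.truncn (a J))%:R <= K%:R :> R.
  have : a J <= K%:R by rewrite /a ler_piMr// ler_pdivrMr// mul1r ler_nat.
  by apply: le_trans; rewrite truncn_le.
set s := \sum_(_ < _) _; set q := (Num.truncn _)%:R => qK H.
have -> : N.+1%:R^-1 * s - G (a J) / K%:R = K%:R^-1 * (K%:R / N.+1%:R * s - G (a J)).
  by field; rewrite !lt0r_neq0.
rewrite normrM gtr0_norm ?invr_gt0// ler_pdivrMl//.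
by apply: (le_trans H); rewrite mulrC ler_pM2r.
Qed.

(** The wave has mean 1/2 over each period. After division by the frequency [K] the deviation is at
    most [1 / K], which makes fast waves average out. *)
Lemma square_wave_primitive_half u : 0 <= u -> `|G u - u / 2| <= 1.
Proof.
move=> u0; have /andP[] := truncn_itv u0; rewrite /square_wave_primitive.
set q := Num.truncn u.
have : q%:R = (odd q)%:R + 2 * q./2%:R :> R.
  by rewrite -[q in LHS]odd_double_half natrD -mul2n natrM.
by rewrite ler_norml -(natr1 q); case: (odd q) => /=; lra.
Qed.

(** The parity of [q] is [q - 2 * q./2], so the wave is built from two nondecreasing functions. *)
Lemma measurable_square_wave K : measurable_fun [set: R] (@square_wave R K).
Proof.
have homoK (x y : R) : x <= y -> K%:R * x <= K%:R * y by move=> xy; rewrite ler_wpM2l.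
have -> : @square_wave R K = (fun t => (Num.truncn (K%:R * t))%:R -
    2 * (Num.truncn (K%:R * t))./2%:R).
  apply/funext => t; rewrite /square_wave.
  rewrite -[X in _ = X%:R - _]odd_double_half natrD -mul2n natrM; ring.
apply: measurable_funB; last apply: measurable_funM => //.
- apply: nondecreasing_measurable => // x y /homoK xy.
  by rewrite ler_nat le_truncn.
- apply: nondecreasing_measurable => // x y /homoK xy.
  by rewrite ler_nat half_leq// le_truncn.
Qed.

(** Whenever the wave changes value, the integer part of [K * t] grows by at least 1; the variation
    is therefore dominated by the total growth of that monotone function, at most [K]. *)
Lemma square_wave_variation K : (paper_variation (@square_wave R K) 0 1 < +oo)%E.
Proof.
apply: (@le_lt_trans _ _ K%:R%:E); last exact: ltry.
apply: ge_ereal_sup => _ [t0 [s [t00 + + ->]]].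
pose q t := (Num.truncn (K%:R * t))%:R : R.
have K1 : q 1 <= K%:R by rewrite /q mulr1 natrK.
suff H : sorted <%R (t0 :: s) ->
    \sum_(i < size s) `|square_wave K s`_i - square_wave K (t0 :: s)`_i|
    <= q (last t0 s) - q t0.
  move=> /H {}H t1; rewrite lee_fin (le_trans H)// t1.
  by have : 0 <= q t0 :> R by []; lra.
elim: s t0 {t00} => [t0 _|t1 s IH t0 /=]; first by rewrite big_ord0 subrr.
move=> /andP[t01 /IH]; rewrite big_ord_recl /=.
suff : `|square_wave K t1 - square_wave K t0| <= q t1 - q t0.
  move=> h1 h2; under eq_bigr do rewrite add0n.
  by apply: le_trans (lerD h1 h2) _; rewrite addrC addrA subrK.
have := @le_truncn R (K%:R * t0) (K%:R * t1).
rewrite ler_wpM2l ?(ltW t01)// => /(_ isT); rewrite /q /square_wave.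
rewrite leq_eqVlt => /predU1P[->|t10]; first by rewrite !subrr normr0.
apply: (@le_trans _ _ 1); last by rewrite -natrB ?ler1n ?subn_gt0// ltnW.
by rewrite ler_norml; case: odd; case: odd => /=; lra.
Qed.

End square_wave.

(* The index set is cut into consecutive blocks b = 0, 1, 2, ... of length b+1;
   block_pos i is the pair (block of i, offset of i in its block). *)
Fixpoint block_pos (i : nat) : nat * nat :=
  if i is k.+1 then
    let: (b, j) := block_pos k in if (j < b)%N then (b, j.+1) else (b.+1, 0%N)
  else (0%N, 0%N).

Lemma block_pos_le i : ((block_pos i).2 <= (block_pos i).1)%N.
Proof. by elim: i => //= i; case: (block_pos i) => b j /=; case: ifP. Qed.

Lemma block_pos_homo : {homo (fun i => (block_pos i).1) : i k / (i <= k)%N}.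
Proof.
apply: homo_leq => // [|i /=]; first exact: leq_trans.
by case: (block_pos i) => b j; case: ifP.
Qed.

Lemma block_pos_index i :
  (2 * i = (block_pos i).1 * (block_pos i).1.+1 + 2 * (block_pos i).2)%N.
Proof.
elim: i => //= i; have := block_pos_le i; case: (block_pos i) => b j /=.
by case: ltnP => /= h1 h2 h3; nia.
Qed.

(** * From block averages to running averages; sums over a regular grid *)

Section block_averages.
Context {R : realType}.

Lemma sum_block_pos (F : nat * nat -> R) n :
  \sum_(i < n) F (block_pos i) =
  \sum_(b < (block_pos n).1) \sum_(j < b.+1) F (b : nat, j : nat) +
  \sum_(j < (block_pos n).2) F ((block_pos n).1, j : nat).
Proof.
elim: n => [|n IH]; first by rewrite !big_ord0 addr0.
rewrite big_ord_recr/= {}IH; have := block_pos_le n.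
case: (block_pos n) => b j /=; case: ltnP => /= [_ _|bj jb].
  by rewrite [in RHS]big_ord_recr/= addrA.
have -> : j = b by apply/eqP; rewrite eqn_leq jb.
by rewrite big_ord0 addr0 [in RHS]big_ord_recr/= [in RHS]big_ord_recr/= addrA.
Qed.

(** A Cesàro argument: complete blocks inherit the limit [L], and the unfinished block has only
    order [sqrt n] terms, negligible because [c] is bounded. *)
Lemma cvg_block_average (c : nat * nat -> R) (M L : R) :
  (forall p, `|c p| <= M) ->
  b.+1%:R^-1 * (\sum_(j < b.+1) c (b, j : nat)) @[b --> \oo] --> L ->
  n%:R^-1 * (\sum_(i < n) c (block_pos i)) @[n --> \oo] --> L.
Proof.
move=> cM /cvgrPdist_le cL; apply/cvgrPdist_le => e e0.
(* One [d] each for the blocks before [B0], the later complete blocks, and the unfinished block. *)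
have [d d0 ->] : exists2 d : R, 0 < d & e = 3 * d.
  by exists (e / 3); [rewrite divr_gt0|field].
have [B0 _ HB0] := cL _ d0.
pose D b : R := `|\sum_(j < b.+1) (c (b, j : nat) - L)|.
pose M' := M + `|L|.
have M'0 : 0 <= M' by rewrite addr_ge0// (le_trans _ (cM (0%N, 0%N))).
have cM' p : `|c p - L| <= M' by rewrite (le_trans (ler_normB _ _))// lerD2r.
have HD b : (B0 <= b)%N -> D b <= d * b.+1%:R.
  move=> /HB0 /=; rewrite /D big_split/= sumr_const card_ord mulNrn -(mulr_natr L).
  have b0 : 0 < b.+1%:R :> R by [].
  set s := \sum_(_ < _) _ => h.
  have -> : s - L * b.+1%:R = - (L - b.+1%:R^-1 * s) * b.+1%:R.
    by field; rewrite lt0r_neq0.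
  by rewrite normrM normrN (gtr0_norm b0) ler_pM2r.
pose C := \sum_(b < B0) D b.
have C0 : 0 <= C by apply: sumr_ge0 => i _; exact: normr_ge0.
have SD B : 2 * \sum_(b < B) D b <= 2 * C + d * (B * B.+1)%:R.
  have [BB0|/ltnW B0B] := leqP B B0.
    have : \sum_(b < B) D b <= C.
      rewrite /C (big_ord_widen _ _ BB0) [leRHS](bigID (fun i : 'I_B0 => (i < B)%N))/=.
      by rewrite lerDl sumr_ge0// => i _; exact: normr_ge0.
    have : 0 <= d * (B * B.+1)%:R by rewrite mulr_ge0// ltW.
    lra.
  rewrite -(subnK B0B); elim: (B - B0)%N => [|k IH].
    by rewrite add0n -/C lerDl mulr_ge0// ltW.
  rewrite addSn big_ord_recr/=.
  have := HD (k + B0)%N (leq_addl _ _); move: IH.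
  have -> : ((k + B0).+1 * (k + B0).+2 = (k + B0) * (k + B0).+1 + 2 * (k + B0).+1)%N by nia.
  by rewrite natrD natrM; lra.
near=> n.
have n0 : 0 < n%:R :> R by rewrite ltr0n; near: n; exists 1%N.
have nC : C <= d * n%:R.
  by rewrite mulrC -ler_pdivrMr//; near: n; exact: nbhs_infty_ger.
(* Together with [b ^ 2 <= 2 * n] this gives, after squaring, [M' * b <= d * n] for the unfinished
   block. *)
have nM : 2 * M' ^+ 2 <= d ^+ 2 * n%:R.
  rewrite mulrC [leRHS]mulrC -ler_pdivrMr ?exprn_gt0//; near: n; exact: nbhs_infty_ger.
have -> : L - n%:R^-1 * \sum_(i < n) c (block_pos i) =
          - (n%:R^-1 * \sum_(i < n) (c (block_pos i) - L)).
  rewrite big_split/= sumr_const card_ord mulNrn -(mulr_natr L).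
  by field; rewrite lt0r_neq0.
rewrite normrN normrM gtr0_norm ?invr_gt0// ler_pdivrMl//.
rewrite (sum_block_pos (fun p => c p - L)).
have := block_pos_index n; have := block_pos_le n; case: (block_pos n) => b j /= jb nbj.
have nR : 2 * n%:R = (b * b.+1)%:R + 2 * j%:R :> R.
  by rewrite -!natrM -natrD nbj.
have bn : b%:R ^+ 2 <= 2 * n%:R :> R by rewrite -natrX -natrM ler_nat; nia.
have Mb : M' * b%:R <= d * n%:R.
  rewrite -ler_sqr ?nnegrE ?mulr_ge0// ?(ltW d0)// !exprMn.
  apply: (@le_trans _ _ (M' ^+ 2 * (2 * n%:R))); first by rewrite ler_wpM2l// sqr_ge0.
  rewrite mulrA [_ * 2]mulrC (expr2 n%:R) mulrA ler_wpM2r//.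
apply: (le_trans (ler_normD _ _)).
have h1 : `|\sum_(b0 < b) \sum_(j0 < b0.+1) (c (b0 : nat, j0 : nat) - L)| <= \sum_(b0 < b) D b0.
  exact: ler_norm_sum.
have h2 : `|\sum_(j0 < j) (c (b, j0 : nat) - L)| <= M' * b%:R.
  apply: (le_trans (ler_norm_sum _ _ _)).
  apply: (@le_trans _ _ (\sum_(j0 < j) M')); first exact: ler_sum.
  by rewrite sumr_const card_ord -[M' *+ j]mulr_natr ler_wpM2l// ler_nat.
have h3 : d * (b * b.+1)%:R <= d * (2 * n%:R).
  by rewrite ler_pM2l// nR lerDl mulr_ge0.
have := SD b; move: h1 h2 h3 Mb nC nR.
set s1 := \sum_(_ < _) D _; lra.
Unshelve. all: by end_near.
Qed.

(** The grid points below [t] form an initial segment. Its length [J] does not depend on [f], so the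
    same cutoff serves both the design points and the labels. *)
Lemma grid_sum_le (t : R) (N : nat) : (0 < N)%N -> exists J : nat,
  [/\ (J <= N)%N,
      forall f : nat -> R,
        \sum_(j < N) f j * (j%:R / N%:R \in `]-oo, t]%classic)%:R = \sum_(j < J) f j &
      `|J%:R / N%:R - Num.max 0 (Num.min 1 t)| <= N%:R^-1].
Proof.
move=> N0; have NR : 0 < N%:R :> R by rewrite ltr0n.
have [t0|t0] := ltP t 0.
  exists 0%N; split => //.
    move=> f; rewrite big_ord0 big1// => j _.
    rewrite memNset ?mulr0//= in_itv/= => h.
    by have := le_lt_trans h t0; rewrite ltNge divr_ge0.
  rewrite mul0r; have -> : Num.min 1 t = t by apply: min_r; lra.
  by rewrite max_l ?(ltW t0)// subrr normr0 invr_ge0.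
have Nt0 : 0 <= N%:R * t by rewrite mulr_ge0.
have inE' j : (j%:R / N%:R \in `]-oo, t]%classic) = (j < (Num.truncn (N%:R * t)).+1)%N.
  rewrite mem_setE in_itv/= ltnS truncn_ge_nat// ler_pdivrMr// mulrC //.
(* The indices 0 to the integer part of [N * t] qualify, hence the successor; the cap [N] is needed
   because the grid stops before 1. *)
exists (minn N (Num.truncn (N%:R * t)).+1); split => [||].
- exact: geq_minl.
- move=> f; rewrite (big_ord_widen N f (geq_minl _ _)) [RHS]big_mkcond/=.
  apply: eq_bigr => j _; rewrite inE' leq_min ltn_ord /=.
  by case: ifP; rewrite ?mulr1 ?mulr0.
- have /andP[h1 h2] := truncn_itv Nt0.
  set J := (minn _ _)%:R; set c := Num.max _ _.
  have -> : J / N%:R - c = (J - c * N%:R) / N%:R by field; exact: lt0r_neq0.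
  rewrite normrM [`|N%:R^-1|]gtr0_norm ?invr_gt0// ler_piMl ?invr_ge0//.
  rewrite {}/J {}/c.
  have [t1|t1] := leP 1 t.
    rewrite max_r// mul1r (minn_idPl _) ?subrr ?normr0//.
    by rewrite ltnW// ltnS truncn_ge_nat// ler_peMr.
  rewrite max_r// (minn_idPr _); last first.
    by rewrite truncn_lt_nat// gtr_pMr.
  by move: h2; rewrite ler_norml -natr1; lra.
Qed.

(** Grid points are distinct, so at most one term survives. *)
Lemma grid_sum_singleton (t : R) (N : nat) (f : nat -> R) :
  (forall j, `|f j| <= 1) ->
  `|\sum_(j < N) f j * (j%:R / N%:R \in [set t])%:R| <= 1.
Proof.
move=> f1; case: N => [|N]; first by rewrite big_ord0 normr0.
have [[j0 j0t]|nt] := pselect (exists j0 : 'I_N.+1, j0%:R / N.+1%:R = t).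
  rewrite (bigD1 j0)//= big1 ?addr0; last first.
    move=> j jj0; rewrite memNset ?mulr0// => /= jt; move/eqP: jj0; apply.
    apply/val_inj/eqP; rewrite -(eqr_nat R); apply/eqP.
    by apply: (@mulIf _ N.+1%:R^-1); rewrite ?j0t ?jt// invr_neq0// pnatr_eq0.
  by rewrite mem_set// mulr1.
rewrite big1 ?normr0// => j _; rewrite memNset ?mulr0// => jt; apply: nt.
by exists j.
Qed.

End block_averages.

(** * The uniform distribution and integrals of the limiting regressions *)

Section uniform_measure.
Context {R : realType}.
Local Notation G := (@square_wave_primitive R).
Local Notation clip t := (Num.max 0 (Num.min 1 t)).

Lemma lam_itv_infty (t : R) : lam R `]-oo, t]%classic = (clip t)%:E.
Proof.
rewrite /lam/= /mrestr.
have [t0|t0] := ltP t 0.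
  rewrite max_l ?ge_min ?(ltW t0) ?orbT//.
  rewrite (_ : _ `&` _ = set0) ?measure0//; apply/seteqP; split => // x [/=].
  by rewrite !in_itv/= => h /andP[]; lra.
rewrite (_ : _ `&` _ = `[0, Num.min 1 t]%classic); last first.
  apply/seteqP; split => x /=; rewrite !in_itv/= le_min.
    by move=> [-> /andP[-> ->]].
  by move=> /and3P[-> -> ->].
have c0 : 0 <= Num.min 1 t by rewrite le_min ler01.
rewrite max_r// lebesgue_measure_itv/= lte_fin; case: ltP => [_|h].
  by rewrite EFinN sube0.
by congr EFin; apply/esym/eqP; rewrite eq_le h.
Qed.

Lemma lam_setT : lam R [set: R] = 1%E.
Proof.
rewrite /lam/= /mrestr setTI lebesgue_measure_itv/= lte_fin ltr01.
by rewrite EFinN sube0.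
Qed.

Lemma lam_set1 (t : R) : lam R [set t] = 0%E.
Proof.
apply/eqP; rewrite eq_le measure_ge0 andbT -(lebesgue_measure_set1 t).
by rewrite /lam/= /mrestr le_measure ?inE//; apply: measurableI.
Qed.

Lemma lam_itv_above (t : R) : lam R `[Num.min 1 t, t]%classic = 0%E.
Proof.
apply/eqP; rewrite eq_le measure_ge0 andbT -(lebesgue_measure_set1 (Num.min 1 t)).
rewrite /lam/= /mrestr le_measure ?inE//; first by apply: measurableI; exact: measurable_itv.
move=> x [/=]; rewrite !in_itv/= => /andP[h1 h2] /andP[_ h3].
by apply/eqP; rewrite eq_le h1 le_min h2 h3.
Qed.

Lemma lam_itv (a t : R) : 0 <= a -> a <= t -> t <= 1 ->
  lam R `[a, t[%classic = (t - a)%:E.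
Proof.
move=> a0 at_ t1; rewrite /lam/= /mrestr setIidl; last first.
  by move=> x /=; rewrite !in_itv/= => /andP[h1 h2]; lra.
rewrite lebesgue_measure_itv/= lte_fin; case: ltP => // h.
by congr EFin; lra.
Qed.

Lemma measurable_EFin_square_wave K (A : set R) :
  measurable A -> measurable_fun A (fun x => (square_wave K x)%:E : \bar R).
Proof.
move=> mA; apply/measurable_EFinP.
by apply: measurable_funS (measurable_square_wave K).
Qed.

(** Induction on the number of complete constancy intervals left of [t]: split at the last
    breakpoint [a], beyond which the wave is constant. *)
Lemma integral_square_wave K (t : R) : (0 < K)%N -> 0 <= t -> t <= 1 ->
  (\int[lam R]_(x in `]-oo, t[) (square_wave K x)%:E = (G (K%:R * t) / K%:R)%:E)%E.
Proof.
move=> K0 t0 t1; have KR : 0 < K%:R :> R by rewrite ltr0n.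
have Kt0 : 0 <= K%:R * t by rewrite mulr_ge0.
(* The upper bound is weakened to [<=] so that the induction hypothesis applies at the breakpoint
   itself, where [K * a = q.+1]. *)
have /andP[qt /ltW tq] := truncn_itv Kt0.
move: {Kt0} (Num.truncn _) qt tq => q.
elim: q t t0 t1 => [|q IH] t t0 t1 qt tq.
  rewrite (square_wave_primitiveE 0) ?qt//= mul0r addr0 mul0r.
  apply: integral0_eq => x /=; rewrite in_itv/= => xt.
  rewrite /square_wave (truncn0Pn _ _)//= -ltNge.
  by apply: lt_le_trans tq; rewrite ltr_pM2l.
pose a : R := q.+1%:R / K%:R.
have Ka : K%:R * a = q.+1%:R by rewrite /a mulrC divfK// lt0r_neq0.
have a0 : 0 <= a by rewrite divr_ge0.
have at_ : a <= t by rewrite /a ler_pdivrMr// mulrC.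
rewrite (_ : `]-oo, t[%classic = `]-oo, a[%classic `|` `[a, t[%classic); last first.
  apply/seteqP; split => x /=; rewrite !in_itv/=.
    by move=> ->; case: (ltP x a) => h; [left|right].
  by move=> [h|/andP[]//]; apply: lt_le_trans at_.
rewrite ge0_integral_setU//=; first last.
- apply/eqP/seteqP; split => // x [/=]; rewrite !in_itv/= => h /andP[]; lra.
- by move=> x _; rewrite lee_fin square_wave_ge0.
- by apply: measurable_EFin_square_wave; apply: measurableU; exact: measurable_itv.
rewrite IH//; [|lra|by rewrite Ka ler_nat|by rewrite Ka].
have -> : (\int[lam R]_(x in `[a, t[) (square_wave K x)%:E =
           \int[lam R]_(x in `[a, t[) (cst ((odd q.+1)%:R)%:E x))%E.
  apply: eq_integral => x; rewrite inE/= in_itv/= => /andP[ax xt].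
  rewrite /square_wave (@truncn_def _ _ q.+1)// -Ka ler_pM2l// ax/=.
  by apply: lt_le_trans tq; rewrite ltr_pM2l.
rewrite integral_cst; last exact: measurable_itv.
rewrite lam_itv// -EFinM -EFinD Ka; congr EFin.
have -> : G q.+1%:R = q.+1./2%:R.
  by rewrite /square_wave_primitive natrK subrr mulr0 addr0.
rewrite (square_wave_primitiveE q.+1 (K%:R * t)) ?qt//.
by rewrite /a; field; exact: lt0r_neq0.
Qed.

Lemma nu_of_square_wave K (t : R) : (0 < K)%N ->
  nu_of (lam R) (square_wave K) `]-oo, t]%classic = G (K%:R * clip t) / K%:R.
Proof.
move=> K0; rewrite /nu_of; have [t0|t0] := ltP t 0.
  rewrite max_l ?ge_min ?(ltW t0) ?orbT// mulr0 square_wave_primitive0 mul0r.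
  rewrite integral0_eq// => x /=; rewrite in_itv/= => xt.
  (* At negative arguments [Num.truncn] is 0, so the wave vanishes there. *)
  rewrite /square_wave (truncn0Pn _ _)//= -ltNge.
  by apply: le_lt_trans (@ltr01 R); rewrite mulr_ge0_le0//; lra.
have c0 : 0 <= Num.min 1 t by rewrite le_min ler01.
have c1 : Num.min 1 t <= 1 by rewrite ge_min lexx.
have ct : Num.min 1 t <= t by rewrite ge_min lexx orbT.
rewrite max_r//.
rewrite (_ : `]-oo, t]%classic =
  `]-oo, Num.min 1 t[%classic `|` `[Num.min 1 t, t]%classic); last first.
  apply/seteqP; split => x /=; rewrite !in_itv/=.
    by move=> ->; case: (ltP x (Num.min 1 t)) => h; [left|right].
  by move=> [h|/andP[]//]; apply/ltW; apply: lt_le_trans ct.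
rewrite ge0_integral_setU//=; first last.
- apply/eqP/seteqP; split => // x [/=]; rewrite !in_itv/= => h /andP[]; lra.
- by move=> x _; rewrite lee_fin square_wave_ge0.
- by apply: measurable_EFin_square_wave; apply: measurableU; exact: measurable_itv.
rewrite integral_square_wave// null_set_integral ?adde0//; last exact: lam_itv_above.
by apply: measurable_EFin_square_wave; exact: measurable_itv.
Qed.

Lemma nu_of_half (t : R) :
  nu_of (lam R) (cst (2^-1)) `]-oo, t]%classic = clip t / 2.
Proof.
rewrite /nu_of (_ : (fun z => _) = cst (2^-1)%:E)// integral_cst; last first.
  exact: measurable_itv.
by rewrite lam_itv_infty/= mulrC.
Qed.

Lemma nu_of_set1 (m : R -> R) (t : R) : measurable_fun [set: R] m ->
  nu_of (lam R) m [set t] = 0.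
Proof.
move=> mm; rewrite /nu_of null_set_integral//; last exact: lam_set1.
by apply/measurable_EFinP; apply: measurable_funS mm.
Qed.

Lemma lam_integrable01 (m : R -> R) : measurable_fun [set: R] m ->
  (forall x, 0 <= m x <= 1) -> (lam R).-integrable [set: R] (EFin \o m).
Proof.
move=> mm m01; apply: measurable_bounded_integrable => //.
  by rewrite lam_setT ltry.
exists 1; split => // M M1 x _ /=.
by have /andP[h0 h1] := m01 x; rewrite ger0_norm// (le_trans h1)// ltW.
Qed.

End uniform_measure.

(** * Design points, labels, and a criterion for stability *)

Section adversary.
Context {R : realType}.
Local Notation G := (@square_wave_primitive R).
Local Notation clip t := (Num.max 0 (Num.min 1 t)).

Definition grid_point (p : nat * nat) : R := p.2%:R / p.1.+1%:R.

Definition grid_seq (i : nat) : R := grid_point (block_pos i).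

(** [s] is a schedule of frequencies by block. The frequency is fixed within a block, so each block
    average is a Riemann sum of a single wave. *)
Definition wave_labels (s : nat -> nat) (i : nat) : R :=
  square_wave (s (block_pos i).1) (grid_seq i).

Lemma grid_seq01 i : grid_seq i \in `[0, 1].
Proof.
rewrite /grid_seq /grid_point in_itv/= divr_ge0//= ler_pdivrMr// mul1r ler_nat.
exact: leqW (block_pos_le i).
Qed.

Lemma cvg_harmonic_bound (u : nat -> R) (l : R) :
  (forall b, `|u b - l| <= b.+1%:R^-1) -> u @ \oo --> l.
Proof.
move=> ul; apply/cvgrPdist_le => e e0; near=> b.
rewrite distrC (le_trans (ul b))// -[leRHS]invrK lef_pV2 ?posrE ?invr_gt0//.
apply: (@le_trans _ _ b%:R); last by rewrite ler_nat.
by near: b; exact: nbhs_infty_ger.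
Unshelve. all: by end_near.
Qed.

(** Two errors add up: [s b / b.+1] from the Riemann sum, and [1 / b.+1] from moving the grid cutoff
    to the clipped [t], as [G] is 1-Lipschitz. *)
Lemma wave_labels_block_average s (t : R) b : (0 < s b)%N ->
  `|b.+1%:R^-1 * (\sum_(j < b.+1) square_wave (s b) (grid_point (b, j : nat)) *
        (grid_point (b, j : nat) \in `]-oo, t]%classic)%:R)
    - G ((s b)%:R * clip t) / (s b)%:R| <= (s b).+1%:R / b.+1%:R.
Proof.
move=> sb0; have sbR : 0 < (s b)%:R :> R by rewrite ltr0n.
have [J [JN Jsum Jt]] := grid_sum_le t b.+1 isT.
rewrite (Jsum (fun j => square_wave (s b) (grid_point (b, j)))).
have := @square_wave_riemann R (s b) b.+1 J sb0 JN.
set A := _ * \sum_(_ < _) _ => hA.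
suff : `|G ((s b)%:R * (J%:R / b.+1%:R)) / (s b)%:R - G ((s b)%:R * clip t) / (s b)%:R|
    <= b.+1%:R^-1.
  move=> hG; have -> : (s b).+1%:R / b.+1%:R = (s b)%:R / b.+1%:R + b.+1%:R^-1 :> R.
    by rewrite -[(s b).+1%:R]natr1 mulrDl mul1r.
  by apply: le_trans _ (lerD hA hG); apply: ler_distD.
rewrite -mulrBl normrM (gtr0_norm (_ : 0 < (s b)%:R^-1)) ?invr_gt0//.
rewrite ler_pdivrMr//; apply: (@le_trans _ _ `|(s b)%:R * (J%:R / b.+1%:R) - (s b)%:R * clip t|).
  apply: square_wave_primitive_lipschitz; rewrite mulr_ge0//.
  by rewrite le_max lexx.
by rewrite -mulrBr normrM gtr0_norm// mulrC ler_pM2r.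
Qed.

(** Everything is checked on block averages. Stability thus reduces to convergence of the normalized
    primitives, provided the frequency is negligible against the block length. *)
Lemma Omega_wave_labels s (m : R -> R) : measurable_fun [set: R] m ->
  (forall t, G ((s b)%:R * clip t) / (s b)%:R @[b --> \oo]
     --> nu_of (lam R) m `]-oo, t]%classic) ->
  (forall b, 0 < s b)%N ->
  (s b).+1%:R / b.+1%:R @[b --> \oo] --> (0 : R) ->
  Omega (lam R) m grid_seq (wave_labels s).
Proof.
move=> mm Gm s0 sb t.
have bound1 (a : R) (c : bool) : `|a| <= 1 -> `|a * c%:R| <= 1.
  by case: c; rewrite ?mulr1// mulr0 normr0 ler01.
have wave1 K x : `|@square_wave R K x| <= 1.
  by rewrite ger0_norm ?square_wave_ge0// square_wave_le1.
have single (f : nat -> nat -> R) : (forall b j, `|f b j| <= 1) ->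
    b.+1%:R^-1 * (\sum_(j < b.+1) f b j * (grid_point (b, j : nat) \in [set t])%:R)
      @[b --> \oo] --> (0 : R).
  move=> f1; apply: cvg_harmonic_bound => b.
  rewrite subr0 normrM gtr0_norm ?invr_gt0// ler_piMr//.
  exact: (grid_sum_singleton t b.+1 (f b)).
split.
- rewrite lam_itv_infty /=.
  apply: (@cvg_block_average _ (fun p => (grid_point p \in _)%:R) 1).
    by move=> p; rewrite ger0_norm// lern1 leq_b1.
  apply: cvg_harmonic_bound => b.
  have [J [_ Jsum Jt]] := grid_sum_le t b.+1 isT.
  rewrite (_ : \sum_(j < b.+1) _ = J%:R); first by rewrite mulrC.
  have := Jsum (fun=> 1); rewrite /= sumr_const card_ord => <-.
  by apply: eq_bigr => j _; rewrite mul1r.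
- rewrite lam_set1.
  apply: (@cvg_block_average _ (fun p => (grid_point p \in _)%:R) 1).
    by move=> p; rewrite ger0_norm// lern1 leq_b1.
  rewrite (_ : (fun b => _) = fun b => b.+1%:R^-1 *
      (\sum_(j < b.+1) 1 * (grid_point (b, j : nat) \in [set t])%:R)).
    by apply: (single (fun _ _ => 1)) => *; rewrite normr1.
  by apply/funext => b; congr (_ * _); apply: eq_bigr => j _; rewrite mul1r.
- apply: (@cvg_block_average _
    (fun p => square_wave (s p.1) (grid_point p) * (grid_point p \in _)%:R) 1).
    by move=> p; exact: bound1.
  set A := (fun b => _ * _) => /=; pose g b := G ((s b)%:R * clip t) / (s b)%:R.
  have -> : A = (fun b => (A b - g b) + g b) by apply/funext => b; rewrite subrK.
  rewrite -[nu_of _ _ _]add0r; apply: cvgD; last exact: Gm.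
  apply: (@squeeze_cvgr _ _ _ _ (fun b => - ((s b).+1%:R / b.+1%:R))
    (fun b => (s b).+1%:R / b.+1%:R)) => //; last first.
    by rewrite -oppr0; exact: cvgN.
  by near=> b; rewrite -ler_norml; exact: wave_labels_block_average.
- rewrite nu_of_set1//.
  apply: (@cvg_block_average _
    (fun p => square_wave (s p.1) (grid_point p) * (grid_point p \in _)%:R) 1).
    by move=> p; exact: bound1.
  exact: (single (fun b j => square_wave (s b) (grid_point (b, j)))).
Unshelve. all: by end_near.
Qed.

End adversary.

(** * Limits of the two kinds of schedule, and the ingredients of the diagonal argument *)

Section adversary_limits.
Context {R : realType}.
Local Notation clip t := (Num.max 0 (Num.min 1 t)).

Lemma Omega_eventually_wave (s : nat -> nat) (K B : nat) : (forall b, 0 < s b)%N ->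
  (forall b, (B <= b)%N -> s b = K) ->
  Omega (lam R) (square_wave K) grid_seq (wave_labels s).
Proof.
move=> s0 sK; have K0 : (0 < K)%N by rewrite -(sK B)//.
apply: Omega_wave_labels => //; first exact: measurable_square_wave.
  move=> t; rewrite nu_of_square_wave//; apply: cvg_near_cst.
  by exists B => // b /= /sK ->.
apply: (@cvg_trans _ ((K.+1%:R / b.+1%:R : R) @[b --> \oo])).
  by apply: near_eq_cvg; exists B => // b /= /sK ->.
by have := cvgM (cvg_cst (K.+1%:R : R)) (@cvg_harmonic R); rewrite mulr0; apply.
Qed.

Lemma Omega_divergent_waves (s : nat -> nat) : (forall b, 0 < s b)%N ->
  (forall b, s b ^ 2 <= b.+1)%N ->
  (forall k, exists B, forall b, (B <= b)%N -> (k <= s b)%N) ->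
  Omega (lam R) (cst 2^-1) grid_seq (wave_labels s).
Proof.
move=> s0 s2 s_oo.
have sV : (s b)%:R^-1 @[b --> \oo] --> (0 : R).
  apply/cvgrPdist_le => e e0; have [B HB] := s_oo (Num.truncn e^-1).+1.
  exists B => // b /= /HB sb; rewrite sub0r normrN ger0_norm//.
  rewrite -[leRHS]invrK lef_pV2 ?posrE ?invr_gt0// ?ltr0n//.
  by apply/ltW/(lt_le_trans (truncnS_gt _)); rewrite ler_nat.
apply: Omega_wave_labels => //.
- move=> t; rewrite nu_of_half; apply/cvgrPdist_le => e e0.
  move/cvgrPdist_le: sV => /(_ e e0); apply: filterS => b.
  rewrite sub0r normrN ger0_norm//; apply: le_trans.
  have sb : 0 < (s b)%:R :> R by rewrite ltr0n.
  have c0 : 0 <= (s b)%:R * clip t by rewrite mulr_ge0// le_max lexx.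
  rewrite distrC (_ : _ - _ = (square_wave_primitive ((s b)%:R * clip t) -
    (s b)%:R * clip t / 2) / (s b)%:R); last by field; exact: lt0r_neq0.
  rewrite normrM [`|_^-1|]gtr0_norm ?invr_gt0//.
  by rewrite ler_piMl ?invr_ge0//; exact: square_wave_primitive_half.
(* From [s b ^ 2 <= b.+1] and [1 <= s b] one gets [s b * (s b + 1) <= 2 * b.+1], hence the majorant
   [2 / s b]. *)
- apply: (@squeeze_cvgr _ _ _ _ (fun=> 0) (fun b => 2 * (s b)%:R^-1)).
  + near=> b; rewrite divr_ge0//=.
    have sb : 0 < (s b)%:R :> R by rewrite ltr0n.
    rewrite ler_pdivrMr// mulrAC ler_pdivlMr// -natrM -natrM ler_nat.
    by have := s2 b; have := s0 b; nia.
  + exact: cvg_cst.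
  + by have := cvgM (cvg_cst (2 : R)) sV; rewrite mulr0; apply.
Unshelve. all: by end_near.
Qed.

(** Changing the schedule on later blocks leaves what the procedure has seen, hence its estimate,
    untouched. *)
Lemma sample_wave_labels (s s' : nat -> nat) (n : nat) :
  (forall b, (b <= (block_pos n).1)%N -> s b = s' b) ->
  sample (@grid_seq R) (wave_labels s) n = sample grid_seq (wave_labels s') n.
Proof.
move=> ss'; apply/eq_in_map => i; rewrite mem_iota add0n => /andP[_ /ltnW ni].
by rewrite /wave_labels ss'//; exact: block_pos_homo.
Qed.

Lemma variation_cst (c : R) : (paper_variation (cst c) 0 1 < +oo)%E.
Proof.
apply: (@le_lt_trans _ _ 0%E); last exact: ltry.
apply: ge_ereal_sup => _ [t0 [s [_ _ _ ->]]].
by rewrite big1// => i _; rewrite subrr normr0.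
Qed.

(* The square wave has L2 distance 1/2 from the constant 1/2. *)
Lemma square_wave_L2_separation (f : R -> R) (K : nat) : measurable_fun [set: R] f ->
  (\int[lam R]_z ((f z - square_wave K z) ^+ 2)%:E < (16%:R^-1)%:E)%E ->
  (\int[lam R]_z ((f z - cst 2^-1 z) ^+ 2)%:E < (16%:R^-1)%:E)%E -> False.
Proof.
move=> mf h1 h2.
have msq (g : R -> R) : measurable_fun [set: R] g ->
    measurable_fun [set: R] (fun z => ((f z - g z) ^+ 2)%:E : \bar R).
  move=> mg; apply/measurable_EFinP; apply: measurable_funX.
  exact: measurable_funB.
have mw := msq _ (measurable_square_wave K).
have mc := msq (cst 2^-1) (measurable_cst _).
have ge0sq (g : R -> R) (z : R) : (0 <= ((f z - g z) ^+ 2)%:E)%E.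
  by rewrite lee_fin sqr_ge0.
(* Pointwise, with [w] equal to 0 or 1 and [c] the midpoint of [w] and 1/2, [(f - w)^2 + (f - 1/2)^2
   = 2 * (f - c)^2 + 1/8]. Two errors below 1/16 cannot add up to 1/8. *)
have : (\int[lam R]_z (cst (8%:R^-1)%:E z) <=
    \int[lam R]_z (((f z - square_wave K z) ^+ 2)%:E + ((f z - cst 2^-1 z) ^+ 2)%:E))%E.
  apply: ge0_le_integral => //.
  - by move=> z _; rewrite lee_fin invr_ge0.
  - exact: emeasurable_funD.
  - move=> z _; rewrite -EFinD lee_fin.
    have [->|->] := square_wave01 K z; rewrite /cst.
      by have := sqr_ge0 (f z - 4%:R^-1); nra.
    by have := sqr_ge0 (f z - 3%:R / 4%:R); nra.
rewrite ge0_integralD// integral_cst// lam_setT mule1 leNgt => /negP; apply.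
apply: lt_le_trans (lteD h1 h2) _.
by rewrite -EFinD lee_fin; lra.
Qed.

End adversary_limits.

(** * The adversarial schedule and the contradiction *)

Theorem theorem2 (R : realType)
    (phi : nat -> seq (R * R) -> R -> R)
    (phi_meas : forall (n : nat) (s : seq (R * R)), size s = n ->
        measurable_fun [set: R] (phi n s)) :
  exists (m : R -> R) (x y : nat -> R),
    [/\ measurable_fun [set: R] m,
        (@lam R).-integrable [set: R] (EFin \o m) /\
          (paper_variation m 0 1 < +oo)%E,
        Omega (@lam R) m x y,
        (forall i, x i \in `[0, 1]) /\ (forall i, y i = 0 \/ y i = 1) &
        ~ ((fun n => \int[@lam R]_z ((phi n (sample x y n) z - m z) ^+ 2)%:E)%E
             @ \oo --> 0%E)].
Proof.
apply: contrapT => consistent.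
pose err (s : nat -> nat) (m : R -> R) (n : nat) : \bar R := (\int[lam R]_z
  ((phi n (sample (@grid_seq R) (wave_labels s) n) z - m z) ^+ 2)%:E)%E.
have small_err (s : nat -> nat) (m : R -> R) :
    measurable_fun [set: R] m -> (forall z, 0 <= m z <= 1) ->
    (paper_variation m 0 1 < +oo)%E -> Omega (lam R) m grid_seq (wave_labels s) ->
    exists N, forall n, (N <= n)%N -> (err s m n < (16%:R^-1)%:E)%E.
  move=> mm m01 Vm Om.
  have cvg_err : err s m @ \oo --> 0%E.
    apply: contrapT => ncvg; apply: consistent.
    exists m, grid_seq, (wave_labels s); split => //.
      by split => //; exact: lam_integrable01.
    by split=> i; [exact: grid_seq01|exact: square_wave01].
  have [|N _ HN] := cvg_err [set u | (u < (16%:R^-1)%:E)%E].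
    by apply: open_ereal_lt'; rewrite lte_fin invr_gt0.
  by exists N => n /HN.
(* A state ((s, B), k) is a schedule of frequencies equal to k from block B on. *)
pose valid (p : (nat -> nat) * nat * nat) :=
  (0 < p.2)%N /\ (forall b, (0 < p.1.1 b)%N) /\ forall b, (p.1.2 <= b)%N -> p.1.1 b = p.2.
(* [B'] is the next switching block: after the current one, late enough for frequency [k + 1] to
   respect the growth bound, and past a time [n >= k] at which the estimate is close to the current
   wave. *)
pose good p B' := [/\ (p.1.2 < B')%N, (p.2.+1 ^ 2 <= B'.+1)%N &
  exists n, [/\ (p.2 <= n)%N, ((block_pos n).1 < B')%N &
    (err p.1.1 (square_wave p.2) n < (16%:R^-1)%:E)%E]].
have [next nextP] : {f : (nat -> nat) * nat * nat -> nat &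
    forall p, valid p -> good p (f p)}.
  (* The choice function is total; invalid states get the dummy value 0. At a valid state the
     schedule is eventually constant, so [small_err] supplies the time [n]. *)
  apply: (@choice _ _ (fun p B' => valid p -> good p B')) => p.
  have [vp|nvp] := pselect (valid p); last by exists 0%N.
  have [k0 [s0 sk]] := vp.
  have [||||N HN] := small_err p.1.1 (square_wave p.2).
  - exact: measurable_square_wave.
  - by move=> z; rewrite square_wave_ge0 square_wave_le1.
  - exact: square_wave_variation.
  - exact: (Omega_eventually_wave _ _ p.1.2).
  pose n := maxn N p.2.
  exists (maxn (maxn p.1.2.+1 (p.2.+1 ^ 2)) (block_pos n).1.+1) => _.
  split; [lia|lia|exists n; split; [lia|lia|]].
  by apply: HN; exact: leq_maxl.
pose step p := ((fun b => if (b < next p)%N then p.1.1 b else p.2.+1), next p, p.2.+1).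
pose st k := iter k step ((fun=> 1%N), 0%N, 1%N).
pose S k := (st k).1.1; pose B k := (st k).1.2.
have st2 k : (st k).2 = k.+1 by elim: k => // k IH; rewrite /st iterS -/(st k) /= IH.
have SS k b : S k.+1 b = if (b < B k.+1)%N then S k b else k.+2.
  by have -> : k.+2 = (st k).2.+1 by rewrite st2.
have val k : valid (st k).
  elim: k => [|k [IH1 [IH2 IH3]]]; first by split.
  split; first by rewrite st2.
  split=> b; rewrite -/(S _) SS; first by case: ifP => // _; exact: IH2.
  by rewrite -/(B _) st2 ltnNge => ->.
have gd k : good (st k) (B k.+1) by exact: nextP.
have BS k : (B k < B k.+1)%N by have [] := gd k.
have B_homo : {homo B : k l / (k <= l)%N}.
  by apply: homo_leq => // [|k]; [exact: leq_trans|exact/ltnW/BS].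
have kB k : (k <= B k)%N by elim: k => // k IH; exact: leq_ltn_trans (BS k).
have S2 k b : (S k b ^ 2 <= b.+1)%N.
  elim: k => // k IH; rewrite SS; case: ltnP => // Bb.
  by have [_ + _] := gd k; rewrite st2 => h; apply: leq_trans h _.
(* Stages after [k] alter only blocks from [B k.+1] on. *)
have stable k l b : (k <= l)%N -> (b < B k.+1)%N -> S l b = S k b.
  move=> /subnK <- bB; elim: (l - k)%N => // d IH.
  rewrite addSn SS IH; case: ltnP => //.
  by rewrite leqNgt (leq_trans bB)//; apply: B_homo; rewrite ltnS leq_addl.
have S_ge k l b : (k <= l)%N -> (B k <= b)%N -> (k < S l b)%N.
  move=> /subnK <- Bb; elim: (l - k)%N => [|d IH].
    by rewrite add0n; have [_ [_ h]] := val k; rewrite [S k b]h ?st2.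
  by rewrite addSn SS; case: ifP => // _; rewrite ltnS; lia.
(* The diagonal is the limit schedule: since [b < B b.+1], stage [b] already has the final value at
   block [b]. *)
pose s b := S b b.
have sS k b : (b < B k.+1)%N -> s b = S k b.
  move=> bB; have [kb|/ltnW bk] := leqP k b; first exact: stable.
  by apply/esym/stable => //; exact: kB.
have [||||N HN] := small_err s (cst 2^-1).
- exact: measurable_cst.
- by move=> z /=; lra.
- exact: variation_cst.
- apply: Omega_divergent_waves => [b|b|k].
  + by have [_ [h _]] := val b; exact: h.
  + exact: S2.
  + exists (B k) => b Bb; apply/ltnW/S_ge => //; exact: leq_trans (kB k) Bb.
(* The threshold [N] also serves as the stage number: the good time [n] of stage [N] exceeds [N] and
   its block precedes [B N.+1], so [s] and [S N] give the same sample. That one estimate is close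
   both to the wave of frequency [N.+1] and to 1/2. *)
have [_ _ [n [Nn nB nerr]]] := gd N; move: Nn nerr; rewrite st2 => Nn nerr.
apply: (@square_wave_L2_separation R
    (phi n (sample grid_seq (wave_labels s) n)) N.+1).
- by apply: phi_meas; rewrite size_map size_iota.
- rewrite (@sample_wave_labels R s (S N))// => b bn; apply: sS.
  exact: leq_ltn_trans nB.
- by apply: HN; exact: ltnW.
Qed.
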